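(* Let $G$ and $H$ be finite groups with a common subgroup $K$, and let $G*_KH$ be the free product of $G$ and $H$ amalgamated over $K$, with generating set $X:=(G\cup H\cup K)\setminus\{1\}$. Then the geodesic conjugacy language $\widetilde\Gamma(G*_KH,X)$ is a regular language and the geodesic conjugacy growth series $\widetilde\gamma(G*_KH,X)$ is a rational function.
   Context: For a group $G$ with finite inverse-closed generating set $X$, let $\pi:X^*\to G$ be the natural projection and $l(w)$ the length of a word $w\in X^*$. For $g\in G$, $|g|$ is the length of a shortest word over $X$ representing $g$, and $|g|_c:=\min\{|h| : h\text{ conjugate to }g\text{ in }G\}$. The geodesic conjugacy language is $\widetilde\Gamma(G,X):=\{w\in X^*: l(w)=|\pi(w)|_c\}$, and the geodesic conjugacy growth series is $\widetilde\gamma(G,X)(z):=\sum_{i\ge0}|\{w\in\widetilde\Gamma(G,X): l(w)=i\}|\,z^i$. A language is regular if it is accepted by a finite state automaton; a power series is rational if it is the expansion of a quotient of two polynomials. *)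

(* Defs.v *)
From HB Require Import structures.
From mathcomp Require Import all_boot all_order all_algebra all_fingroup.
From mathcomp Require Import boolp classical_sets.

Set Implicit Arguments.
Unset Strict Implicit.
Unset Printing Implicit Defensive.

Import GRing.Theory.

Local Open Scope group_scope.

(* The minimum of a set of natural numbers; the empty set gets the junk value
   0, which never matters below when the words over X represent all of P. *)
Definition nat_min (A : set nat) : nat :=
  xget 0%N [set n | A n /\ forall m, A m -> n <= m]%classic.

Section ConjugacyGeometry.

Context {P : groupType}.
Implicit Types (X : seq P) (g h : P).

(* The finite generating set is given by a list X; repetitions in X are
   irrelevant, as [seq_sub X] is the finite type of the elements of X. *)
Definition word X : Type := seq (seq_sub X).

Definition word_val X (w : word X) : P := \prod_(x <- w) ssval x.

Definition word_length X g : nat :=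
  nat_min [set n | exists2 w : word X, word_val w = g & size w = n]%classic.

Definition conjugate g h : Prop := exists x : P, h = g ^ x.

Definition conj_length X g : nat :=
  nat_min [set word_length X h | h in conjugate g]%classic.

Definition geod_conj_language X : set (word X) :=
  [set w : word X | size w = conj_length X (word_val w)]%classic.

End ConjugacyGeometry.

Arguments geod_conj_language {P} X.

Record dfa (A : finType) := Dfa {
  dfa_state : finType;
  dfa_start : dfa_state;
  dfa_final : {set dfa_state};
  dfa_trans : dfa_state -> A -> dfa_state
}.

Definition dfa_accepts (A : finType) (M : dfa A) (w : seq A) : bool :=
  foldl (@dfa_trans A M) (dfa_start M) w \in dfa_final M.

Definition regular_language (A : finType) (L : set (seq A)) : Prop :=
  exists M : dfa A, forall w : seq A, L w <-> dfa_accepts M w.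

(* A formal power series is represented by its coefficient sequence. *)
Definition growth_series (A : finType) (L : set (seq A)) (n : nat) : rat :=
  #|[pred w : n.-tuple A | `[< L w >]]|%:R%R.

(* The series a is the expansion at 0 of p / q, i.e. q * a = p as formal power
   series, where q has a nonzero constant term. *)
Definition rational_series (a : nat -> rat) : Prop :=
  (exists p q : {poly rat}, q`_0 != 0 /\
     forall n : nat, \sum_(i < n.+1) q`_i * a (n - i)%N = p`_n)%R.

(* P, with iG and iH, is the free product of G and H amalgamated along the
   embeddings jG : K -> G and jH : K -> H, i.e. their pushout in the category
   of groups ({multiplicative _ -> _} between groups is the type of group
   homomorphisms: preservation of 1 and inverses is automatic). *)
Record is_amalgam (K G H P : groupType)
    (jG : {multiplicative K -> G}) (jH : {multiplicative K -> H})
    (iG : {multiplicative G -> P}) (iH : {multiplicative H -> P}) : Prop := {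
  amalgam_comm : forall k : K, iG (jG k) = iH (jH k);
  amalgam_ext : forall (T : groupType)
      (f : {multiplicative G -> T}) (g : {multiplicative H -> T}),
    (forall k : K, f (jG k) = g (jH k)) ->
    exists u : {multiplicative P -> T},
      (forall x : G, u (iG x) = f x) /\ (forall y : H, u (iH y) = g y);
  amalgam_uniq : forall (T : groupType) (u v : {multiplicative P -> T}),
    (forall x : G, u (iG x) = v (iG x)) ->
    (forall y : H, u (iH y) = v (iH y)) -> u =1 v
}.

(* The union of the images of G, H and K in P, minus the identity. *)
Definition amalgam_gens (K G H : finGroupType) (P : groupType)
    (jG : {multiplicative K -> G})
    (iG : {multiplicative G -> P}) (iH : {multiplicative H -> P}) : seq P :=
  [seq x <- codom iG ++ codom iH ++ codom (fun k : K => iG (jG k)) | x != 1].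

(* Main.v *)
(* Write X-letters outside K as being on the G-side or on the H-side. A word w
   of length at least 2 is geodesic up to conjugacy iff it alternates cyclically
   between the two sides. If two cyclically adjacent letters of w do not
   alternate, they lie in a common factor, so a rotation of w can be shortened.
   Conversely, if w alternates cyclically then so do all its powers; P acts on
   K x (sequences of coset representatives) in such a way that each letter
   changes the length of a sequence by at most 1, while an alternating word of
   length n takes the empty sequence to one of length n. Hence w^m has word
   length m |w| for all m, and comparing growth rates, no conjugate of w is
   shorter than w. This cyclic condition is recognised by an automaton, and
   the transfer matrix of an automaton gives rationality. *)
Require Import Defs.
From HB Require Import structures.
From mathcomp Require Import all_boot all_order all_algebra all_fingroup.
From mathcomp Require Import boolp classical_sets.

Set Implicit Arguments.
Unset Strict Implicit.
Unset Printing Implicit Defensive.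

Local Open Scope group_scope.

(** * Group homomorphisms *)

Lemma multiplicative1 (A B : groupType) (f : {multiplicative A -> B}) :
  f 1 = 1.
Proof. by apply: (mulgI (f 1)); rewrite -gmulfM !mulg1. Qed.

Lemma multiplicativeV (A B : groupType) (f : {multiplicative A -> B}) a :
  f a^-1 = (f a)^-1.
Proof. by apply: (mulgI (f a)); rewrite -gmulfM !mulgV multiplicative1. Qed.

(** * Action of one factor on sequences of coset representatives *)

Section CosetAction.

Variables (K A : finGroupType) (j : {multiplicative K -> A}).
Hypothesis j_inj : injective j.
Variables (L : Type) (emb : A -> L) (prj : L -> option A).
Hypothesis embK : pcancel emb prj.

Lemma image_group_set : group_set (j @: [set: K]).
Proof.
apply/group_setP; split.
  by apply/imsetP; exists 1; rewrite ?multiplicative1.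
move=> _ _ /imsetP[a _ ->] /imsetP[b _ ->].
by apply/imsetP; exists (a * b); rewrite ?gmulfM.
Qed.

Definition image_group : {group A} := Group image_group_set.
Arguments image_group : simpl never.
Local Notation J := image_group.

Lemma mem_image k : j k \in J.
Proof. by apply/imsetP; exists k. Qed.

Lemma mem_image_mul k a : (j k * a \in J) = (a \in J).
Proof. by rewrite groupMl ?mem_image. Qed.

Lemma mem_mul_image k a : (a * j k \in J) = (a \in J).
Proof. by rewrite groupMr ?mem_image. Qed.

Definition coset_rep (a : A) : A := repr (J :* a).

Definition preim (a : A) : K := odflt 1 [pick k | j k == a].

Lemma jK k : preim (j k) = k.
Proof.
rewrite /preim; case: pickP => [k' /eqP/j_inj //|/(_ k)].
by rewrite eqxx.
Qed.

Lemma preimK a : a \in J -> j (preim a) = a.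
Proof. by case/imsetP => k _ ->; rewrite jK. Qed.

Lemma mul_rep_mem a : a * (coset_rep a)^-1 \in J.
Proof.
have := mem_repr_rcoset J a; rewrite -/(coset_rep a) mem_rcoset => h.
by rewrite -groupV invMg invgK.
Qed.

Lemma rep_idem a : coset_rep (coset_rep a) = coset_rep a.
Proof. by rewrite /coset_rep rcoset_repr. Qed.

Lemma repM k a : k \in J -> coset_rep (k * a) = coset_rep a.
Proof. by move=> kJ; rewrite /coset_rep rcosetM (rcoset_id kJ). Qed.

Lemma rep_J a : a \in J -> coset_rep a = 1.
Proof.
by move=> aJ; rewrite /coset_rep rcoset_id ?repr_group.
Qed.

Lemma mem_rep a : (coset_rep a \in J) = (a \in J).
Proof.
have h := mul_rep_mem a.
by rewrite -(groupMl (x := a * (coset_rep a)^-1)) // mulgVK.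
Qed.

(* Instead of restricting to alternating sequences of nontrivial coset
   representatives, all sequences are allowed: a sequence that does not start
   with a representative which could have been split off is inert. *)
Fixpoint splittable (s : seq L) : bool :=
  if s is l :: r then
    if prj l is Some t then
      [&& t \notin J, coset_rep t == t & ~~ splittable r]
    else false
  else false.

(** The pair of [k] and [[:: t1; ...; tn]] stands for the normal form [k * t1 * ... * tn] in the
    amalgam. *)
Definition coset_state : Type := K * seq L.

(** With inverse [join_head], this identifies states with pairs of an element of [A] and an inert
    sequence. Left multiplication on the first component then transports to an action of [A] on
    states. *)
Definition split_head (s : coset_state) : A * seq L :=
  if splittable s.2 then
    (j s.1 * odflt 1 (obind prj (ohead s.2)), behead s.2)
  else (j s.1, s.2).

Definition join_head (p : A * seq L) : coset_state :=
  (preim (p.1 * (coset_rep p.1)^-1),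
   if p.1 \in J then p.2 else emb (coset_rep p.1) :: p.2).

Lemma split_head_inert s : ~~ splittable (split_head s).2.
Proof.
rewrite /split_head; case: ifPn => //=.
by case: s.2 => //= l r; case: (prj l) => // t /and3P[].
Qed.

Lemma join_headK p : ~~ splittable p.2 -> split_head (join_head p) = p.
Proof.
case: p => a r /= rN; rewrite /split_head /join_head /=.
have jE := preimK (mul_rep_mem a).
have [aJ|aJ] := boolP (a \in J).
  by rewrite (negPf rN) jE rep_J // invg1 mulg1.
by rewrite /= embK mem_rep aJ rep_idem eqxx rN /= jE mulgVK.
Qed.

Hypothesis prjK : ocancel prj emb.

Lemma split_headK s : join_head (split_head s) = s.
Proof.
case: s => k s; rewrite /split_head /join_head /=.
case: ifPn => [|_ /=]; last by rewrite rep_J ?mem_image // invg1 mulg1 jK.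
case: s => //= l r; case E: (prj l) => [t|] // /and3P[tJ /eqP tt _] /=.
have := prjK l; rewrite E /= => tl.
by rewrite repM ?mem_image // tt mulgK jK mem_image_mul (negPf tJ) tl.
Qed.

Definition coset_act (a : A) (s : coset_state) : coset_state :=
  join_head (a * (split_head s).1, (split_head s).2).

Lemma coset_act1 s : coset_act 1 s = s.
Proof. by rewrite /coset_act mul1g -surjective_pairing split_headK. Qed.

Lemma coset_actM a b s : coset_act (a * b) s = coset_act a (coset_act b s).
Proof.
by rewrite {2}/coset_act /coset_act join_headK ?split_head_inert //= mulgA.
Qed.

(** The right-hand side does not depend on [A], so the actions of the two factors agree on K. *)
Lemma coset_act_image k s : coset_act (j k) s = (k * s.1, s.2).
Proof.
rewrite -[RHS]split_headK /coset_act /split_head /=.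
by case: ifP => _ /=; rewrite gmulfM // mulgA.
Qed.

Lemma size_coset_act a s : size (coset_act a s).2 <= (size s.2).+1.
Proof.
have : size (split_head s).2 <= size s.2.
  by rewrite /split_head; case: ifP => //= _; rewrite size_behead leq_pred.
by rewrite /coset_act /join_head /=; case: ifP => //= _ /leqW.
Qed.

Lemma coset_act_grow a s : a \notin J -> ~~ splittable s.2 ->
  splittable (coset_act a s).2 /\ size (coset_act a s).2 = (size s.2).+1.
Proof.
move=> aJ sN; rewrite /coset_act /split_head (negPf sN) /join_head /=.
rewrite mem_mul_image (negPf aJ) /= embK mem_rep.
by rewrite mem_mul_image aJ rep_idem eqxx sN.
Qed.

End CosetAction.

(** * The group of permutations of a type, and actions as homomorphisms into it *)

Section SymmetricGroup.

Variable S : Type.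

Definition sym_axiom (p : (S -> S) * (S -> S)) : Prop :=
  cancel p.1 p.2 /\ cancel p.2 p.1.

Record sym : Type :=
  Sym { sym_pair :> (S -> S) * (S -> S); _ : sym_axiom sym_pair }.

Lemma sym_inj : injective sym_pair.
Proof.
move=> [p hp] [q hq] /= pq; case: _ / pq in hq *.
by congr Sym; apply: Prop_irrelevance.
Qed.

Lemma sym_ext (p q : sym) : p.1 =1 q.1 -> p = q.
Proof.
move: p q => [[f g] [/= fK gK]] [[f' g'] [/= f'K g'K]] /= ff'.
apply: sym_inj; congr pair; apply: funext => //= s.
by rewrite -{1}(g'K s) -ff' fK.
Qed.

HB.instance Definition _ := gen_eqMixin sym.
HB.instance Definition _ := gen_choiceMixin sym.

Lemma sym1_axiom : sym_axiom (id, id).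
Proof. by []. Qed.

Lemma symM_axiom (p q : sym) : sym_axiom (p.1 \o q.1, q.2 \o p.2).
Proof.
case: p q => [p [p12 p21]] [q [q12 q21]].
by split; apply: can_comp.
Qed.

Lemma symV_axiom (p : sym) : sym_axiom (p.2, p.1).
Proof. by case: p => p []. Qed.

Definition sym_one := Sym sym1_axiom.
Definition sym_mul p q := Sym (symM_axiom p q).
Definition sym_inv p := Sym (symV_axiom p).

Lemma sym_mulA : associative sym_mul.
Proof. by move=> p q r; apply: sym_ext. Qed.

Lemma sym_mul1 : left_id sym_one sym_mul.
Proof. by move=> p; apply: sym_ext. Qed.

Lemma sym_mulr1 : right_id sym_one sym_mul.
Proof. by move=> p; apply: sym_ext. Qed.

Lemma sym_mulV : left_inverse sym_one sym_inv sym_mul.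
Proof. by move=> [[f g] [/= fK gK]]; apply: sym_ext. Qed.

Lemma sym_mulrV : right_inverse sym_one sym_inv sym_mul.
Proof. by move=> [[f g] [/= fK gK]]; apply: sym_ext. Qed.

HB.instance Definition _ :=
  isGroup.Build sym sym_mulA sym_mul1 sym_mulr1 sym_mulV sym_mulrV.

Section ActionMorphism.

Variables (A : groupType) (act : A -> S -> S).
Hypothesis act1 : forall s, act 1 s = s.
Hypothesis actM : forall a b s, act (a * b) s = act a (act b s).

Lemma act_sym_axiom a : sym_axiom (act a, act a^-1).
Proof. by split=> s /=; rewrite -actM ?mulgV ?mulVg act1. Qed.

Definition act_sym a : sym := Sym (act_sym_axiom a).

Lemma act_symM : {morph act_sym : a b / a * b}.
Proof. by move=> a b; apply: sym_ext => s; apply: actM. Qed.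

HB.instance Definition _ := isMultiplicative.Build A sym act_sym act_symM.

Definition sym_morphism : {multiplicative A -> sym} := act_sym.

End ActionMorphism.

End SymmetricGroup.

(** * Length up to conjugacy *)

Lemma nat_minP (B : set nat) n : B n ->
  B (nat_min B) /\ forall m, B m -> nat_min B <= m.
Proof.
move=> Bn; have exB : exists n, `[< B n >] by exists n; apply/asboolP.
apply: (xgetPex 0%N (P := [set n | B n /\ forall m, B m -> n <= m]%classic)).
case: (ex_minnP exB) => k /asboolP Bk kmin; exists k; split=> // m Bm.
by apply: kmin; apply/asboolP.
Qed.

Section ConjugacyLength.

Variables (P : groupType) (X : seq P).
Implicit Types (v w : word X) (g h : P).

Lemma word_val_cat v w : word_val (v ++ w) = word_val v * word_val w.
Proof. by rewrite /word_val big_cat. Qed.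

Lemma word_val_cons (x : seq_sub X) w :
  word_val (x :: w) = ssval x * word_val w.
Proof. by rewrite /word_val big_cons. Qed.

Lemma word_val_nil : word_val ([::] : word X) = 1.
Proof. by rewrite /word_val big_nil. Qed.

Lemma word_val_nseq m w : word_val (flatten (nseq m w)) = word_val w ^+ m.
Proof.
by elim: m => [|m IH] /=; rewrite ?word_val_nil // word_val_cat IH expgS.
Qed.

Lemma conjugate_refl g : Defs.conjugate g g.
Proof. by exists 1; rewrite conjg1. Qed.

Lemma conjugate_rot n w : Defs.conjugate (word_val (rot n w)) (word_val w).
Proof.
exists (word_val (take n w))^-1.
by rewrite -{1}(cat_take_drop n w) /rot !word_val_cat conjgE invgK mulgK.
Qed.

Lemma conjugate_sym g h : Defs.conjugate g h -> Defs.conjugate h g.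
Proof. by case=> x ->; exists x^-1; rewrite conjgK. Qed.

Lemma conj_length_le g v :
  Defs.conjugate g (word_val v) -> conj_length X g <= size v.
Proof.
move=> gv; have [_ hmin] := @nat_minP
  [set n | exists2 w : word X, word_val w = word_val v & size w = n]%classic
  (size v) (ex_intro2 _ _ v erefl erefl).
apply: leq_trans (hmin _ _); last by exists v.
have [_] := @nat_minP [set word_length X h | h in Defs.conjugate g]%classic
  (word_length X (word_val v)) (ex_intro2 _ _ _ gv erefl).
by apply; exists (word_val v).
Qed.

(** Generation makes every set of word lengths nonempty, so that no minimum takes the junk value
    0. *)
Lemma le_conj_length g n : (forall h, exists w : word X, word_val w = h) ->
  (forall v, Defs.conjugate g (word_val v) -> n <= size v) ->
  n <= conj_length X g.
Proof.
move=> gen hn; rewrite /conj_length.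
have [[h gh <-] _] := @nat_minP
  [set word_length X h | h in Defs.conjugate g]%classic
  (word_length X g) (ex_intro2 _ _ _ (conjugate_refl g) erefl).
have [w wh] := gen h; rewrite /word_length.
have [[v vh <-] _] := @nat_minP
  [set n | exists2 w : word X, word_val w = h & size w = n]%classic
  (size w) (ex_intro2 _ _ w wh erefl).
by apply: hn; rewrite vh.
Qed.

Lemma geod_conj_le_size w v : geod_conj_language X w ->
  Defs.conjugate (word_val w) (word_val v) -> size w <= size v.
Proof. by move=> -> /conj_length_le. Qed.

Lemma geod_conjP w : (forall h, exists w : word X, word_val w = h) ->
  (forall v, Defs.conjugate (word_val w) (word_val v) -> size w <= size v) ->
  geod_conj_language X w.
Proof.
move=> gen hw; apply/eqP; rewrite eqn_leq le_conj_length //=.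
exact/conj_length_le/conjugate_refl.
Qed.

(* The powers of [w] grow as fast as those of any conjugate [v], up to an
   additive constant. *)
Lemma size_le_conjugate (len : P -> nat) w v :
  (forall h, exists w : word X, word_val w = h) ->
  (forall v, len (word_val v) <= size v) ->
  (forall m, len (word_val w ^+ m) = m * size w)%N ->
  Defs.conjugate (word_val w) (word_val v) -> size w <= size v.
Proof.
move=> gen lenle lenw [x vE].
have [a aE] := gen x; have [b bE] := gen x^-1.
rewrite leqNgt; apply/negP => lt.
(* The conjugating words cost a constant [size a + size b], while each factor [v] saves at least one
   letter over [w]; [m] is one more than that constant. *)
have [m mE] : exists m, m = (size a + size b).+1 by eexists.
have wE : word_val (a ++ flatten (nseq m v) ++ b) = word_val w ^+ m.
  rewrite 2!word_val_cat word_val_nseq aE bE vE -conjXg.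
  by move: (word_val w ^+ m) => g; rewrite conjgE !mulgA mulgK mulgV mul1g.
have := lenle (a ++ flatten (nseq m v) ++ b).
rewrite wE lenw !size_cat size_flatten /shape map_nseq.
rewrite sumn_nseq addnCA [(size v * m)%N]mulnC; apply/negP; rewrite -ltnNge.
apply: leq_trans (_ : m * (size v).+1 <= _)%N; last first.
  by rewrite leq_mul2l lt orbT.
by rewrite mulnS addnC ltn_add2r mE.
Qed.

End ConjugacyLength.

(** * Cyclic words *)

Lemma cycleN_rot (T : Type) (r : rel T) (w : seq T) :
  1 < size w -> ~~ path.cycle r w ->
  exists n x y s, rot n w = [:: x, y & s] /\ ~~ r x y.
Proof.
have pathN z s : ~~ path r z s ->
    exists a x y b, z :: s = a ++ [:: x, y & b] /\ ~~ r x y.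
  elim: s z => //= x s IH z; rewrite negb_and => /orP[zx|/IH].
    by exists [::], z, x, s.
  by move=> [a [x' [y [b [-> xy]]]]]; exists (z :: a), x', y, b.
case: w => // z w /= sz /pathN [a [x [y [b [E xy]]]]].
(* If nothing follows the bad pair, it wraps around: [y] is the closing copy of [z], and the
   rotation starts at the last letter. Otherwise the pair lies inside the word. *)
case: (lastP b) E => [|b' z'] E.
  have E' : rcons (z :: w) z = rcons (rcons a x) y.
    by rewrite rcons_cons E -!cats1 -catA.
  have [zw zy] := rcons_inj E'.
  case: a zw {E E'} => [[_ w0]|z' a [_ ->]]; first by rewrite w0 in sz.
  exists (size (z :: a)), x, z, a; split.
    by rewrite -cats1 -cat_cons rot_size_cat.
  by rewrite zy.
have [zw _] : (z :: w, z) = (a ++ [:: x, y & b'], z').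
  by apply: rcons_inj; rewrite rcons_cons E -!cats1 -catA.
by exists (size a), x, y, (b' ++ a); rewrite zw rot_size_cat.
Qed.

(** Each copy of [w] ends at [last x w], where the hypothesis lets the next copy start. *)
Lemma path_nseq (T : Type) (r : rel T) x w m :
  path r (last x w) w -> path r (last x w) (flatten (nseq m w)).
Proof.
move=> pw; elim: m => //= m IH; rewrite cat_path pw /=.
by case: w {pw} IH.
Qed.

(** * Rationality by the transfer matrix *)

Section Rationality.

Import GRing.Theory.
Local Open Scope ring_scope.

Lemma horner_mxE (R : comNzRingType) n (A : 'M[R]_n.+1) (p : {poly R}) :
  horner_mx A p = \sum_(i < size p) p`_i *: A ^+ i.
Proof.
rewrite -{1}[p]coefK poly_def linear_sum; apply: eq_bigr => i _ /=.
by rewrite linearZ /= rmorphXn /= horner_mx_X.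
Qed.

(* By Cayley-Hamilton the sequence satisfies the linear recurrence given by the
   characteristic polynomial, so the reversed characteristic polynomial is a
   denominator. *)
Lemma rational_matrix_powers n (A : 'M[rat]_n.+1) (u : 'rV_n.+1)
    (v : 'cV_n.+1) :
  rational_series (fun m => (u *m A ^+ m *m v) 0 0).
Proof.
set a : nat -> rat := fun m => _; set chi := char_poly A; set d := n.+1.
have sz : size chi = d.+1 by rewrite size_char_poly.
pose q := \poly_(i < d.+1) chi`_(d - i).
(* The numerator collects the coefficients of index below [d], where the recurrence does not yet
   apply. *)
exists (\poly_(m < d) \sum_(i < m.+1) q`_i * a (m - i)%N), q; split.
  rewrite coef_poly /= subn0 -[d]/(d.+1.-1) -sz.
  have /monicP := char_poly_monic A; rewrite lead_coefE => ->.
  exact: oner_neq0.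
move=> m; rewrite coef_poly; case: ltnP => // dm.
transitivity (\sum_(i < d.+1) chi`_(d - i) * a (m - i)%N).
  rewrite (big_ord_widen m.+1 (fun i => chi`_(d - i) * a (m - i)%N)) //.
  rewrite [RHS]big_mkcond; apply: eq_bigr => i _; rewrite coef_poly.
  by case: ifP => //; rewrite mul0r.
(* Reversing the sum undoes the reversal in [q], and [chi] evaluated at [A] appears. *)
rewrite (reindex_inj rev_ord_inj) /=.
transitivity ((u *m A ^+ (m - d) *m horner_mx A chi *m v) 0 0); last first.
  by rewrite Cayley_Hamilton mulmx0 mul0mx mxE.
rewrite horner_mxE sz mulmx_sumr mulmx_suml summxE; apply: eq_bigr => i _.
have id : (i <= d)%N by rewrite -ltnS.
rewrite subSS subKn // -scalemxAr -scalemxAl mxE /a; congr (_ * _).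
rewrite -(mulmxA u (A ^+ (m - d))) mulmxE -exprD.
by rewrite subnBA // addnBAC.
Qed.

Section Dfa.

Variables (A : finType) (M : dfa A).

Definition dfa_count n (s : dfa_state M) : rat :=
  \sum_(w : n.-tuple A) (foldl (@dfa_trans A M) s w \in dfa_final M)%:R.

Lemma dfa_count0 s : dfa_count 0 s = (s \in dfa_final M)%:R.
Proof.
rewrite /dfa_count (big_pred1 [tuple]) //= => w; rewrite (tuple0 w).
exact/esym/eqxx.
Qed.

Lemma dfa_countS n s :
  dfa_count n.+1 s = \sum_(x : A) dfa_count n (dfa_trans s x).
Proof.
rewrite /dfa_count pair_big /=.
rewrite (reindex (fun p : A * n.-tuple A => [tuple of p.1 :: p.2])) //=.
exists (fun w : n.+1.-tuple A => (thead w, [tuple of behead w]))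
  => [[x w] _|w _] /=.
  by rewrite theadE; congr pair; apply: val_inj.
by rewrite [w in RHS]tuple_eta; apply: val_inj.
Qed.

Lemma dfa_count_rational : rational_series (dfa_count ^~ (dfa_start M)).
Proof.
(* The start state makes the dimension positive, as the ring of square matrices requires. *)
have [n cardE] : exists n, #|dfa_state M| = n.+1.
  exists #|dfa_state M|.-1; rewrite prednK //.
  by apply/card_gt0P; exists (dfa_start M).
pose rk s : 'I_n.+1 := cast_ord cardE (enum_rank s).
pose st (i : 'I_n.+1) : dfa_state M := enum_val (cast_ord (esym cardE) i).
have rkK : cancel rk st by move=> s; rewrite /st cast_ordK enum_rankK.
pose T : 'M[rat]_n.+1 :=
  \matrix_(i, j) \sum_(x : A) (rk (dfa_trans (st i) x) == j)%:R.
pose v : 'cV[rat]_n.+1 := \col_i (st i \in dfa_final M)%:R.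
have count m i : (T ^+ m *m v) i 0 = dfa_count m (st i).
  elim: m i => [|m IH] i; first by rewrite expr0 mul1mx mxE dfa_count0.
  rewrite exprS -mulmxA mxE dfa_countS.
  under eq_bigr => j _ do rewrite IH mxE mulr_suml.
  rewrite exchange_big; apply: eq_bigr => x _ /=.
  rewrite (bigD1 (rk (dfa_trans (st i) x))) //= eqxx mul1r rkK.
  rewrite big1 ?addr0 // => j.
  by rewrite eq_sym => /negPf ->; rewrite mul0r.
have [p [q [q0 pq]]] :=
  rational_matrix_powers T (delta_mx 0 (rk (dfa_start M))) v.
exists p, q; split=> // m; rewrite -pq; apply: eq_bigr => i _.
by rewrite -mulmxA -rowE mxE count rkK.
Qed.

End Dfa.

Lemma regular_growth_rational (A : finType) (L : set (seq A)) :
  regular_language L -> rational_series (growth_series L).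
Proof.
case=> M LM; have [p [q [q0 pq]]] := dfa_count_rational M.
exists p, q; split=> // n; rewrite -pq; apply: eq_bigr => i _; congr (_ * _).
rewrite /growth_series /dfa_count -natr_sum; congr _%:R.
rewrite -sum1_card big_mkcond; apply: eq_bigr => w _ /=.
rewrite inE; case: asboolP => [/LM|h].
  by rewrite /dfa_accepts => ->.
by case E: (_ \in _) => //; case: h; apply/LM.
Qed.

End Rationality.

(** * An automaton for cyclic conditions *)

Section CyclicLanguage.

Variables (A : finType) (r : rel A).

(* A state records the first and the last letter read, whether consecutive
   letters were related so far, and whether only one letter was read. *)
Definition cycle_step (s : option (A * A * bool * bool)) (x : A) :=
  if s is Some (f, l, ok, _) then Some (f, x, ok && r l x, false)
  else Some (x, x, true, true).

Definition cycle_final (s : option (A * A * bool * bool)) : bool :=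
  if s is Some (f, l, ok, one) then one || ok && r l f else true.

Lemma cycle_stepE f l ok one w :
  foldl cycle_step (Some (f, l, ok, one)) w
  = Some (f, last l w, ok && path r l w, one && nilp w).
Proof.
elim: w l ok one => [|x w IH] l ok one /=; first by rewrite !andbT.
by rewrite IH andbF andbA.
Qed.

Lemma regular_cycle :
  regular_language [set w : seq A | size w = 1%N \/ path.cycle r w]%classic.
Proof.
exists (@Dfa A _ None [set s | cycle_final s] cycle_step) => w.
rewrite /dfa_accepts inE /=; case: w => [|x w] /=.
  by split=> // _; right.
rewrite cycle_stepE /= rcons_path; split.
  by case=> [[/size0nil ->]|->] //; rewrite orbT.
by case/orP => [/nilP ->|->]; [left | right].
Qed.

End CyclicLanguage.

(** * Subgroups as groups in their own right *)

Section SubgroupType.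

Variables (P : groupType) (S : pred P).

Definition subgroup_type of group_closed S : Type := {x : P | S x}.

Variable S_closed : group_closed S.
Local Notation Q := (subgroup_type S_closed).

HB.instance Definition _ := SubChoice.on Q.
HB.instance Definition _ := SubChoice_isSubGroup.Build P S Q S_closed.

Variables (A : groupType) (f : {multiplicative A -> P}).
Hypothesis f_sub : forall a, S (f a).

Definition corestrict (a : A) : Q := Sub (f a) (f_sub a).

Lemma corestrictM : {morph corestrict : a b / a * b}.
Proof. by move=> a b; apply: val_inj; rewrite valM !SubK gmulfM. Qed.

HB.instance Definition _ := isMultiplicative.Build A Q corestrict corestrictM.

End SubgroupType.

(** * Geodesics up to conjugacy in the amalgam *)

Section Amalgam.

Variables (K G H : finGroupType).
Variables (jG : {multiplicative K -> G}) (jH : {multiplicative K -> H}).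
Hypotheses (jG_inj : injective jG) (jH_inj : injective jH).
Variable P : groupType.
Variables (iG : {multiplicative G -> P}) (iH : {multiplicative H -> P}).
Hypothesis amalgP : is_amalgam jG jH iG iH.

(** The universal property maps [P] into the subgroup [S]. Followed by the inclusion, this map fixes
    both factors, so by uniqueness it is the identity. *)
Lemma amalgam_generated (S : pred P) : group_closed S ->
  (forall x, S (iG x)) -> (forall y, S (iH y)) -> forall p, S p.
Proof.
move=> S_closed SG SH p.
pose f : {multiplicative G -> subgroup_type S_closed} := corestrict S_closed SG.
pose g : {multiplicative H -> subgroup_type S_closed} := corestrict S_closed SH.
have fg k : f (jG k) = g (jH k) by apply/val_inj/(amalgam_comm amalgP).
have [u [uG uH]] := amalgam_ext amalgP fg.
pose v : {multiplicative P -> P} := val \o u.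
have vE : v =1 idfun.
  by apply: (amalgam_uniq amalgP (v := idfun)) => x; rewrite /v /= ?uG ?uH.
by rewrite -[p]vE; apply: valP.
Qed.

Local Notation X := (amalgam_gens jG iG iH).

Lemma mem_amalgam_gens p :
  (p \in X) = (p != 1) && ((p \in codom iG) || (p \in codom iH)).
Proof.
rewrite mem_filter !mem_cat; congr (_ && _); rewrite orbA orbC.
case: codomP => //= -[k ->]; by rewrite codom_f.
Qed.

Lemma amalgam_gens_word p : (p \in codom iG) || (p \in codom iH) ->
  exists w : word X, word_val w = p /\ size w <= 1.
Proof.
move=> pi; have [->|p1] := eqVneq p 1.
  by exists [::]; rewrite word_val_nil.
have pX : p \in X by rewrite mem_amalgam_gens p1.
by exists [:: SeqSub pX]; rewrite word_val_cons word_val_nil mulg1.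
Qed.

Lemma amalgam_gens_generate p : exists w : word X, word_val w = p.
Proof.
apply/asboolP; move: p.
apply: amalgam_generated => [|x|y]; last 2 first.
- apply/asboolP; have [|w [wE _]] := @amalgam_gens_word (iG x).
    by rewrite codom_f.
  by exists w.
- apply/asboolP; have [|w [wE _]] := @amalgam_gens_word (iH y).
    by rewrite codom_f orbT.
  by exists w.
(* [group_closed] asks for closure under quotients, hence the words for inverses. *)
have inv (w : word X) : exists v : word X, word_val v = (word_val w)^-1.
  elim: w => [|x w [v vE]]; first by exists [::]; rewrite word_val_nil invg1.
  have [|u [uE _]] := @amalgam_gens_word (ssval x)^-1.
    have := ssvalP x; rewrite mem_amalgam_gens => /andP[_].
    by case/orP=> /codomP[y ->]; rewrite -multiplicativeV codom_f ?orbT.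
  by exists (v ++ u); rewrite word_val_cat word_val_cons vE uE invgM.
split; first by apply/asboolP; exists [::]; rewrite word_val_nil.
move=> _ _ /asboolP[v <-] /asboolP[w <-].
have [w' w'E] := inv w; apply/asboolP; exists (v ++ w').
by rewrite word_val_cat w'E.
Qed.

(* The intersection of the two factors plays the role of K. *)
Definition side (p : P) : option bool :=
  if p \in codom iG then if p \in codom iH then None else Some true
  else Some false.

Definition alternate (p q : P) : bool :=
  if (side p, side q) is (Some a, Some b) then a != b else false.

(** Letters that do not alternate lie in a common factor: a letter without a side lies in both. *)
Lemma word_merge (x y : seq_sub X) : ~~ alternate (ssval x) (ssval y) ->
  exists w : word X, word_val w = ssval x * ssval y /\ size w <= 1.
Proof.
move=> xy; apply: amalgam_gens_word.
have := ssvalP x; have := ssvalP y; rewrite !mem_amalgam_gens.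
move=> /andP[_ yi] /andP[_ xi]; move: xy xi yi; rewrite /alternate /side.
case xG : (_ \in codom iG); case xH : (_ \in codom iH) => //;
case yG : (_ \in codom iG); case yH : (_ \in codom iH) => // _ _ _.
all: try by move/codomP: xG yG => [a ->] /codomP[b ->]; rewrite -gmulfM codom_f.
all: move/codomP: xH yH => [a ->] /codomP[b ->].
all: by rewrite -gmulfM codom_f orbT.
Qed.

Local Notation letter := (G + H)%type.

(** Tagging the representatives makes a sequence headed by the other factor inert. *)
Definition prjG (l : letter) : option G := if l is inl x then Some x else None.
Definition prjH (l : letter) : option H := if l is inr y then Some y else None.

Definition splits (b : bool) (s : seq letter) : bool :=
  if b then splittable jG prjG s else splittable jH prjH s.

Lemma splitsN b s : splits b s -> ~~ splits (~~ b) s.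
Proof. by case: b; case: s => [|[x|y] s]. Qed.

(** Both actions are homomorphisms into the permutations of the states and agree on K, so they
    extend to [P]. *)
Lemma amalgam_action : exists rho : P -> K * seq letter -> K * seq letter,
  [/\ forall p q s, rho (p * q) s = rho p (rho q s),
      forall s, rho 1 s = s,
      forall x, rho (iG x) =1 coset_act jG inl prjG x &
      forall y, rho (iH y) =1 coset_act jH inr prjH y].
Proof.
have inlK : pcancel inl prjG by [].
have inrK : pcancel inr prjH by [].
have prjGK : ocancel prjG inl by case.
have prjHK : ocancel prjH inr by case.
pose f : {multiplicative G -> sym (K * seq letter)} :=
  sym_morphism (coset_act1 jG_inj prjGK) (coset_actM jG_inj inlK).
pose g : {multiplicative H -> sym (K * seq letter)} :=
  sym_morphism (coset_act1 jH_inj prjHK) (coset_actM jH_inj inrK).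
have fg k : f (jG k) = g (jH k).
  by apply: sym_ext => s /=; rewrite !coset_act_image.
have [u [uG uH]] := amalgam_ext amalgP fg.
exists (fun p => (u p).1); split=> [p q s|s|x s|y s].
- by rewrite gmulfM.
- by rewrite multiplicative1.
- by rewrite uG.
- by rewrite uH.
Qed.

Local Notation alternateX :=
  (fun x y : seq_sub X => alternate (ssval x) (ssval y)).

Lemma amalgam_length : exists len : P -> nat,
  (forall w : word X, len (word_val w) <= size w) /\
  (forall (x : seq_sub X) (w : word X),
     path alternateX x w ->
     len (word_val w) = size w).
Proof.
have [rho [rhoM rho1 rhoG rhoH]] := amalgam_action.
exists (fun p => size (rho p (1, [::])).2); split.
  elim=> [|x w IH] /=; first by rewrite word_val_nil rho1.
  rewrite word_val_cons rhoM; rewrite -ltnS in IH; apply: leq_trans IH.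
  have := ssvalP x; rewrite mem_amalgam_gens => /andP[_ /orP[]] /codomP[y ->].
    by rewrite rhoG size_coset_act.
  by rewrite rhoH size_coset_act.
(* A letter on side [b] acting on a sequence inert for [b] adds a representative, and the result
   splits on side [b]. *)
have grow b p s : p \in X -> side p = Some b -> ~~ splits b s.2 ->
    splits b (rho p s).2 /\ size (rho p s).2 = (size s.2).+1.
  rewrite mem_amalgam_gens /side => /andP[_].
  case pG : (p \in codom iG); case pH : (p \in codom iH) => //= _ [<-] sN.
    case/codomP: pG pH => x -> xH; rewrite rhoG; apply: coset_act_grow => //.
    apply: contraFN xH => /imsetP[k _ ->].
    by rewrite (amalgam_comm amalgP) codom_f.
  case/codomP: pH pG => y -> yG; rewrite rhoH; apply: coset_act_grow => //.
  apply: contraFN yG => /imsetP[k _ ->].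
  by rewrite -(amalgam_comm amalgP) codom_f.
move=> x w; set r := fun _ => _ => xw.
(* Letters act from right to left, so [x] is the next one to act; the invariant adds that the
   sequence is inert for the side of [x]. *)
suff: size (rho (word_val w) (1, [::])).2 = size w /\
      forall b, w != [::] -> side (ssval x) = Some b ->
        ~~ splits b (rho (word_val w) (1, [::])).2 by case.
elim: w x xw => [|y w IH] x /=; first by rewrite word_val_nil rho1.
case/andP=> xy /IH[sz spl]; rewrite word_val_cons rhoM.
move: xy; rewrite /r /alternate; case sx : (side (ssval x)) => [a|] //.
case sy : (side (ssval y)) => [b|] // ab.
have [|||sp szy] := grow b (ssval y) (rho (word_val w) (1, [::])) => //.
- exact: ssvalP.
- case: w sz spl {IH} => [_ _|z w sz spl]; last exact: spl.
  by rewrite word_val_nil rho1; case: (b).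
split=> [|c _ [<-]]; first by rewrite szy sz.
by have := splitsN sp; rewrite (_ : ~~ b = a) //; case: (a) (b) ab => [] [].
Qed.

Lemma geod_conj_amalgam (w : word X) :
  geod_conj_language X w <-> size w = 1%N \/ path.cycle alternateX w.
Proof.
split=> [Lw|].
  have [|sz] := leqP (size w) 1.
    by case: w Lw => [|x [|y w]] // _ _; [right | left].
  right; apply: contraT => /(cycleN_rot sz)[n [x [y [s [E]]]]].
  case/word_merge=> v [vE szv].
  have : size w <= size (v ++ s).
    apply: (geod_conj_le_size Lw); apply: conjugate_sym.
    rewrite word_val_cat vE -mulgA -!word_val_cons -E.
    exact: conjugate_rot.
  by rewrite -(size_rot n) E size_cat /= leqNgt ltnS -add1n leq_add2r szv.
case=> [|cw].
  case: w => [|x [|y w]] // _; apply: (geod_conjP amalgam_gens_generate) => v.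
  (* A shorter conjugate would be empty, hence trivial, but letters differ from [1]. *)
  rewrite word_val_cons word_val_nil mulg1 lt0n size_eq0 => -[p vE].
  apply/eqP => v0; have := ssvalP x; rewrite mem_amalgam_gens => /andP[/eqP[]].
  by apply: (conjg_inj p); rewrite conj1g -vE v0 word_val_nil.
apply: (geod_conjP amalgam_gens_generate) => v.
have [len [len_le lenE]] := amalgam_length.
case: w cw => [|x w] // cw.
apply: (size_le_conjugate amalgam_gens_generate len_le) => m.
(* Cyclic alternation says that the word is an alternating path starting from its own last
   letter. *)
rewrite -word_val_nseq (lenE (last x w)); last first.
  by apply: (@path_nseq _ _ x (x :: w)); move: cw; rewrite /= rcons_path andbC.
by rewrite size_flatten /shape map_nseq sumn_nseq mulnC.
Qed.

End Amalgam.

Theorem proposition3p11 (K G H : finGroupType)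
    (jG : {multiplicative K -> G}) (jH : {multiplicative K -> H})
    (jG_inj : injective jG) (jH_inj : injective jH)
    (P : groupType)
    (iG : {multiplicative G -> P}) (iH : {multiplicative H -> P})
    (amalgP : is_amalgam jG jH iG iH) :
  let L := geod_conj_language (amalgam_gens jG iG iH) in
  regular_language L /\ rational_series (growth_series L).
Proof.
move=> L; have reg : regular_language L.
  rewrite (_ : L = [set w | size w = 1%N \/ path.cycle
    (fun x y => alternate iG iH (ssval x) (ssval y)) w]%classic).
    exact: regular_cycle.
  by apply/seteqP; split=> w /(geod_conj_amalgam jG_inj jH_inj amalgP).
by split=> //; apply: regular_growth_rational.
Qed.
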